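(* There is a non-empty compact metrizable space $X$ such that the set $C_1(X)=\{x\in X : \{x\}\text{ is a connected component of }X\}$ is a dense and co-dense $G_\delta$ subset of $X$, and $X$ is reconstructible.
   Context: For a topological space $X$, $[Y]$ denotes the homeomorphism class of $Y$, and the deck of $X$ is the set $\mathcal{D}(X)=\{[X\setminus\{x\}] : x\in X\}$. The space $X$ is reconstructible if every topological space $Z$ with $\mathcal{D}(Z)=\mathcal{D}(X)$ is homeomorphic to $X$. A subset is co-dense if its complement is dense; a $G_\delta$ set is a countable intersection of open sets. *)

(* Defs.v *)
From HB Require Import structures.
From mathcomp Require Import all_boot all_order all_algebra.
From mathcomp Require Import all_classical all_reals all_analysis.
From mathcomp Require Import borel_hierarchy.

Set Implicit Arguments.
Unset Strict Implicit.
Unset Printing Implicit Defensive.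

Local Open Scope classical_set_scope.

Definition homeomorphic (X Y : topologicalType) : Prop :=
  exists (f : X -> Y) (g : Y -> X),
    [/\ continuous f, continuous g, cancel f g & cancel g f].

(* Homeomorphism classes and decks are predicates [_ -> Prop] rather than
   [set _]: instantiating [set] at [topologicalType] would constrain the
   universe of [set] above that of topological spaces. *)
Definition homeo_class (Y : topologicalType) : topologicalType -> Prop :=
  fun W => homeomorphic Y W.

(* [set_type A] carries the initial topology of the inclusion, unlike
   [subspace A], whose carrier is all of [X]. *)
Definition deck (X : topologicalType) : (topologicalType -> Prop) -> Prop :=
  fun c => exists x : X, c = homeo_class (set_type (~` [set x])).

Definition reconstructible (X : topologicalType) : Prop :=
  forall Z : topologicalType, deck Z = deck X -> homeomorphic Z X.

Definition metrizable (R : realType) (X : topologicalType) : Prop :=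
  exists M : metricType R, homeomorphic X M.

Definition C1 (X : topologicalType) : set X :=
  [set x | connected_component [set: X] x = [set x]].

Arguments C1 : clear implicits.

Definition codense (X : topologicalType) (A : set X) : Prop := dense (~` A).

(* Main.v *)
Require Import Defs.
From HB Require Import structures.
From mathcomp Require Import all_boot all_order all_algebra.
From mathcomp Require Import all_classical all_reals all_analysis.
From mathcomp Require Import borel_hierarchy lra.

(** Let Z have the same deck as a compact Hausdorff space X. If Z minus z is
    homeomorphic to X minus x, a part of Z lying far from z, near the end of Z,
    reappears in X close to x. If Z is not compact, a non-empty open piece of it
    can be chosen far from two given points, hence the same piece occurs in X
    close to any two points of X. This is impossible when X is the union of two
    disjoint non-empty closed sets A and B such that no non-empty open subset
    of B embeds into A; see [reconstructible_split]. If instead Z is compact,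
    then Z and X both arise from a common card by adding one point to make it
    compact, hence are homeomorphic.

    The space is built from three infinite sequences: bits x (with x_0 = 1),
    heights t in the unit interval, and bits z called labels. If n < m are
    positions of consecutive ones of x, then t_n is prescribed to be the m-th
    term d_m of a sequence that returns densely to the whole unit interval; if
    x_n = 0, then t_n = 0. If n is the position of the last one of x, then t_n
    is free. Hence the fibre over x and z is a point when x has infinitely many ones
    and an arc when it has finitely many. Every condition is closed and
    involves finitely many coordinates, so the space is compact by Tychonoff.
    Since bits are locally constant, connected sets stay inside one fibre, and
    C1 consists of the points with infinitely many ones, a G-delta. It is dense
    because the next one of x can be inserted at a position m for which d_m is
    close to the free height, and co-dense because x can be truncated far away.

    Labels make the two sides differ. When z_0 = 0 all labels vanish, and since
    there are only countably many x with finitely many ones, the points of this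
    side with a rational free height form a countable set that meets every
    connected subset with more than one point ([connected_rational_last]). When z_0 = 1 the labels are
    arbitrary, so every non-empty open set contains arcs with uncountably many
    labels. An embedding of such an open set into the side z_0 = 0 would let a
    countable set meet all these arcs, and a diagonal choice of z produces an
    arc that is missed ([no_embedding]). *)

Set Implicit Arguments.
Unset Strict Implicit.
Unset Printing Implicit Defensive.

Import Order.TTheory GRing.Theory Num.Theory.
Import numFieldNormedType.Exports.

Local Open Scope classical_set_scope.
Local Open Scope ring_scope.

(** * Spaces with the same deck *)

(** Continuity away from [z], phrased so that it makes sense before [z] is
    known to be a closed point of [Z]. *)
Definition punctured_continuous (Z X : topologicalType) (f : Z -> X) (z : Z) :=
  forall p, p <> z -> f @ within (~` [set z]) (nbhs p) --> f p.

(** A homeomorphism between the cards at [z] and [x], extended to a bijection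
    of the whole spaces by sending [z] to [x]; this avoids subtypes from here
    on. *)
Definition puncture_iso (Z X : topologicalType) (z : Z) (x : X)
    (f : Z -> X) (g : X -> Z) : Prop :=
  [/\ cancel f g, cancel g f, f z = x,
      punctured_continuous f z & punctured_continuous g x].

Lemma puncture_extend (Z X : topologicalType) (z : Z) (x : X)
    (h : set_type (~` [set z]) -> set_type (~` [set x])) (f : Z -> X) :
  continuous h ->
  (forall p (zp : p \in ~` [set z]), f p = val (h (exist _ p zp))) ->
  punctured_continuous f z.
Proof.
move=> hc fE p pz U.
have zp : p \in ~` [set z] by exact/mem_set.
rewrite (fE p zp) => fU.
have : nbhs (exist _ p zp : set_type (~` [set z])) ((val \o h) @^-1` U).
  apply: (continuous_comp (hc _)) => //.
  exact: initial_continuous.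
move=> [_ [[W oW <-] /= Wp WU]].
rewrite /= nbhs_simpl /= /within /=.
have : nbhs p W by exact: open_nbhs_nbhs.
apply: filterS => q Wq qz.
have zq : q \in ~` [set z] by exact/mem_set.
by rewrite /= (fE q zq); apply: (WU (exist _ q zq)).
Qed.

Lemma puncture_isoP (Z X : topologicalType) (z : Z) (x : X) :
  homeomorphic (set_type (~` [set z])) (set_type (~` [set x])) ->
  exists f g, puncture_iso z x f g.
Proof.
move=> [h [k [hc kc hK kK]]].
pose ext (A B : topologicalType) (a : A) (b : B)
    (u : set_type (~` [set a]) -> set_type (~` [set b])) (p : A) : B :=
  if pselect (p \in ~` [set a]) is left ap then val (u (exist _ p ap)) else b.
have extE A B a b u p ap : @ext A B a b u p = val (u (exist _ p ap)).
  rewrite /ext; case: pselect => // ap'.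
  by rewrite (bool_irrelevance ap' ap).
have ext0 A B a b u : @ext A B a b u a = b.
  by rewrite /ext; case: pselect => // ap; have /set_mem/(_ erefl) := ap.
have extK A B a b u v : cancel u v -> cancel (@ext A B a b u) (@ext B A b a v).
  move=> uK p; have [->|/eqP pa] := eqVneq p a; first by rewrite !ext0.
  have ap : p \in ~` [set a] by exact/mem_set.
  rewrite (extE _ _ _ _ u p ap).
  case E : (u (exist _ p ap)) => [q bq] /=.
  by rewrite (extE _ _ _ _ _ _ bq) -E uK.
exists (ext _ _ z x h), (ext _ _ x z k); split.
- exact: extK.
- exact: extK.
- exact: ext0.
- by apply: (puncture_extend hc) => p zp; exact: extE.
- by apply: (puncture_extend kc) => p zp; exact: extE.
Qed.

Lemma deck_puncture (Z X : topologicalType) : deck Z = deck X ->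
  forall z : Z, exists (x : X) f g, puncture_iso z x f g.
Proof.
move=> eqD z.
have : deck X (homeo_class (set_type (~` [set z]))) by rewrite -eqD; exists z.
move=> [x eqC]; exists x; apply: puncture_isoP.
have : homeo_class (set_type (~` [set x])) (set_type (~` [set x])).
  by exists id, id; split => // u; exact: cvg_id.
by rewrite -eqC.
Qed.

Lemma puncture_isoC (Z X : topologicalType) (z : Z) (x : X) f g :
  puncture_iso z x f g -> puncture_iso x z g f.
Proof. by move=> [fK gK <- fc gc]; split. Qed.

Lemma hausdorff_sep (T : topologicalType) (p q : T) : hausdorff_space T ->
  p <> q -> exists U V, [/\ nbhs p U, nbhs q V & forall r, U r -> V r -> False].
Proof.
move=> hT pq; apply: contrapT => nUV; apply: pq; apply: hT => U V Up Vq.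
apply: contrapT => UV0; apply: nUV; exists U, V; split => // r Ur Vr.
by apply: UV0; exists r.
Qed.

Lemma puncture_iso_continuous (Z X : topologicalType) (z : Z) (x : X) f g p :
  open (~` [set z]) -> puncture_iso z x f g -> p <> z -> {for p, continuous f}.
Proof.
move=> oz [_ _ _ fc _] pz U Up.
have fU : nbhs p (fun q => q <> z -> U (f q)) by exact: (fc p pz U Up).
have zp : nbhs p (~` [set z]) by exact: open_nbhs_nbhs.
suff : nbhs p (f @^-1` U) by [].
by apply: filterS2 zp fU => q qz; apply.
Qed.

(** Equivalently, any two points lie in a common card. *)
Definition third_point (X : Type) := forall a b : X, exists c : X, c <> a /\ c <> b.

Section deck_separation.
Variables (Z X : topologicalType).
Hypothesis hX : hausdorff_space X.
Hypothesis X3 : third_point X.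
Hypothesis ZX : forall z : Z, exists (x : X) f g, puncture_iso z x f g.

Lemma deck_third_point : third_point Z.
Proof.
move=> a b; have [x [f [g [fK gK _ _ _]]]] := ZX a.
have [c [ca cb]] := X3 (f a) (f b).
by exists (g c); split=> E; [apply: ca|apply: cb]; rewrite -E gK.
Qed.

(** The card at a third point [w] is Hausdorff, so [p] has a neighbourhood in it
    that avoids [z]; adding [w] back does no harm because [w] is not [z]. *)
Lemma deck_open_puncture (z : Z) : open (~` [set z]).
Proof.
rewrite openE => p /= pz; rewrite /interior.
have [w [wp wz]] := deck_third_point p z.
have [x [f [g [fK gK _ fc _]]]] := ZX w.
have fpz : f p <> f z by move=> /(can_inj fK).
have [U [V [Up Vz UV]]] := hausdorff_sep hX fpz.
have fU : nbhs p (fun q => q <> w -> U (f q)).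
  exact: (fc p (fun E => wp (esym E)) U Up).
apply: filterS fU => q qU qz.
apply: (UV (f z)); last exact: nbhs_singleton.
by rewrite -qz; apply: qU => qw; apply: wz; rewrite -qw.
Qed.

Lemma deck_hausdorff : hausdorff_space Z.
Proof.
move=> p q pq; apply: contrapT => npq.
have [w [wp wq]] := deck_third_point p q.
have [x [f [g fg]]] := ZX w; have [fK gK _ _ _] := fg.
have fpq : f p <> f q by move=> /(can_inj fK).
have [U [V [Up Vz UV]]] := hausdorff_sep hX fpq.
have fU : nbhs p (f @^-1` U).
  by apply: (puncture_iso_continuous (deck_open_puncture w) fg) => // E; apply: wp.
have fV : nbhs q (f @^-1` V).
  by apply: (puncture_iso_continuous (deck_open_puncture w) fg) => // E; apply: wq.
have [r [Ur Vr]] := pq _ _ fU fV.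
exact: UV Ur Vr.
Qed.
End deck_separation.

Lemma hausdorff_puncture_continuous (Z X : topologicalType) (z : Z) (x : X) f g p :
  hausdorff_space Z -> puncture_iso z x f g -> p <> z -> {for p, continuous f}.
Proof.
move=> hZ; apply: puncture_iso_continuous.
exact/closed_openC/accessible_closed_set1/hausdorff_accessible.
Qed.

(** Uniqueness of the one-point compactification: a neighbourhood of [z] has
    compact complement, which [f] carries to a closed set missing [x]. *)
Lemma puncture_iso_compact_continuous (Z X : topologicalType) (z : Z) (x : X) f g :
  hausdorff_space Z -> hausdorff_space X -> compact [set: Z] ->
  puncture_iso z x f g -> continuous g.
Proof.
move=> hZ hX cZ fg p; have [fK gK fz _ _] := fg.
have [->|/eqP px] := eqVneq p x; last first.
  exact: (hausdorff_puncture_continuous hX (puncture_isoC fg)).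
rewrite -fz => U; rewrite fK nbhsE => -[V [oV Vz] VU].
have cfV : compact (f @` (~` V)).
  apply: continuous_compact.
    apply: continuous_in_subspaceT => q /set_mem qV.
    by apply: (hausdorff_puncture_continuous hZ fg) => qz; apply: qV; rewrite qz.
  by apply: (subclosed_compact _ cZ) => //; exact: open_closedC.
have oW : open (~` (f @` (~` V))).
  exact: closed_openC (compact_closed hX cfV).
rewrite /= nbhs_simpl /=.
apply: (@filterS _ _ _ (~` (f @` (~` V)))).
  move=> q qV; apply: VU; apply: contrapT => ngV.
  by apply: qV; exists (g q) => //; rewrite gK.
apply: open_nbhs_nbhs; split => // -[q qV /(can_inj fK) qz].
by apply: qV; rewrite qz.
Qed.

(** Local compactness of [Z] at [z], read off in the card at another point [w]:
    in [X], the complement of an open neighbourhood of [x] is compact. *)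
Lemma deck_compact_nbhs (Z X : topologicalType) (z w : Z) (x : X) f g :
  hausdorff_space Z -> hausdorff_space X -> compact [set: X] ->
  puncture_iso w x f g -> z <> w -> exists2 K : set Z, compact K & nbhs z K.
Proof.
move=> hZ hX cX fg zw; have [fK gK fw _ _] := fg.
have fzx : f z <> x by rewrite -fw => /(can_inj fK).
have [U [V [Uz Vx UV]]] := hausdorff_sep hX fzx.
move: Vx; rewrite nbhsE => -[V' [oV' V'x] V'V].
exists (g @` (~` V')).
  apply: continuous_compact.
    apply: continuous_in_subspaceT => q /set_mem qV.
    by apply: (hausdorff_puncture_continuous hX (puncture_isoC fg)) => qx; apply: qV; rewrite qx.
  by apply: (subclosed_compact _ cX) => //; exact: open_closedC.
have := hausdorff_puncture_continuous hZ fg zw Uz; rewrite /= nbhs_simpl /=.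
apply: filterS => q Uq; exists (f q); rewrite ?fK// => Vq.
exact: UV Uq (V'V _ Vq).
Qed.

(** If [Z] is not compact, choose cards [Z] minus [z1] and [Z] minus [z2] that
    come from removing [a] in [A] and [b] in [B]. As [B] is compact and misses
    [a], its preimage in the first card is compact; so is the preimage of [A] in
    the second. What is left of [Z] after removing these compact sets and compact
    neighbourhoods of [z1] and [z2] is open and non-empty, lies in [B] by the
    second card and in [A] by the first. *)
Lemma reconstructible_split (X : topologicalType) (A B : set X) (a b : X) :
  compact [set: X] -> hausdorff_space X -> third_point X ->
  closed A -> closed B -> A a -> B b -> (forall p, A p <-> ~ B p) ->
  (forall (O : set X) (h : X -> X), open O -> O !=set0 -> O `<=` B ->
     (forall p, O p -> {for p, continuous h}) ->
     {in O &, injective h} -> ~ (h @` O `<=` A)) ->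
  reconstructible X.
Proof.
move=> cX hX X3 cA cB Aa Bb AB noemb Z eqD.
have ZX := deck_puncture eqD.
have XZ := deck_puncture (esym eqD).
have hZ := deck_hausdorff hX X3 ZX.
have Z3 := deck_third_point X3 ZX.
suff cZ : compact [set: Z].
  have [z [f [g fg]]] := XZ a; have [fK gK _ _ _] := fg.
  exists g, f; split => //.
  - exact: (puncture_iso_compact_continuous hX hZ cX fg).
  - exact: (puncture_iso_compact_continuous hZ hX cZ (puncture_isoC fg)).
apply: contrapT => ncZ.
have comp_side (x : X) (C : set X) : closed C -> ~ C x ->
    exists (z : Z) f g N D, [/\ puncture_iso z x f g, compact N, nbhs z N,
                      compact D & forall p, C (f p) -> D p].
  move=> cC Cx; have [z [g [f gf]]] := XZ x.
  have fg := puncture_isoC gf; have [fK gK _ _ _] := fg.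
  have [w [wz _]] := Z3 z z; have [y [f' [g' fg']]] := ZX w.
  have [N cN zN] := deck_compact_nbhs hZ hX cX fg' (fun E => wz (esym E)).
  exists z, f, g, N, (g @` C); split => //.
    apply: continuous_compact.
      apply: continuous_in_subspaceT => q /set_mem qC.
      by apply: (hausdorff_puncture_continuous hX gf) => qx; apply: Cx; rewrite -qx.
    exact: (subclosed_compact cC cX).
  by move=> p Cp; exists (f p).
have nBa : ~ B a by exact/AB.
have nAb : ~ A b by move=> /AB.
have [z1 [f1 [g1 [N1 [D1 [fg1 cN1 zN1 cD1 D1P]]]]]] := comp_side a B cB nBa.
have [z2 [f2 [g2 [N2 [D2 [fg2 cN2 zN2 cD2 D2P]]]]]] := comp_side b A cA nAb.
have [f1K g1K _ _ _] := fg1; have [f2K g2K _ _ _] := fg2.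
pose K := (N1 `|` D1) `|` (N2 `|` D2).
have cK : compact K by do 2?apply: compactU => //.
have oW : open (~` K) by exact: closed_openC (compact_closed hZ cK).
have [w Ww] : ~` K !=set0.
  apply: contrapT => K0; apply: ncZ; suff -> : [set: Z] = K by [].
  apply/seteqP; split => // p _; apply: contrapT => nKp; apply: K0; by exists p.
have Wz1 p : ~ K p -> p <> z1.
  by move=> Kp pz; apply: Kp; rewrite pz; left; left; exact: nbhs_singleton.
have Wz2 p : ~ K p -> p <> z2.
  by move=> Kp pz; apply: Kp; rewrite pz; right; left; exact: nbhs_singleton.
have g2c p : ~ K (g2 p) -> {for p, continuous g2}.
  move=> Kp; apply: (hausdorff_puncture_continuous hX (puncture_isoC fg2)) => pb.
  by apply: (Wz2 _ Kp); have [_ _ <- _ _] := puncture_isoC fg2; rewrite pb.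
apply: (noemb (g2 @^-1` (~` K)) (f1 \o g2)).
- rewrite openE => p Kp; rewrite /interior; apply: (g2c p Kp).
  exact: open_nbhs_nbhs.
- by exists (f2 w) => /=; rewrite f2K.
- move=> p /= Kp; apply: contrapT => nBp; apply: Kp; right; right.
  by apply: D2P; rewrite g2K; apply/AB.
- move=> p Kp; apply: continuous_comp; first exact: g2c.
  exact: (hausdorff_puncture_continuous hZ fg1 (Wz1 _ Kp)).
- by move=> p q _ _ /= /(can_inj f1K)/(can_inj g2K).
- move=> _ [p Kp <-] /=; apply/AB => Bp; apply: Kp; left; right; exact: D1P.
Qed.

(** * Metrizability of Hausdorff pseudometric spaces *)

Section hausdorff_pseudometric.
Variables (R : realType) (T : pseudoMetricType R).
Hypothesis hT : hausdorff_space T.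

(** Balls of a pseudometric structure need not be the open balls of a distance;
    the infimum of the radii whose balls join two points is a distance with the
    same topology. The radii from 1 on are always admitted, so that the infimum
    is over a non-empty set at any two points. *)
Let radii (x y : T) : set R := [set e | 0 < e /\ (ball x e y \/ 1 <= e)].
Let dist (x y : T) : R := inf (radii x y).

Let has_inf_radii x y : has_inf (radii x y).
Proof.
split; first by exists 1; split => //; right.
by exists 0 => e [/ltW].
Qed.

Let dist_le x y e : 0 < e -> ball x e y -> dist x y <= e.
Proof. by move=> e0 xy; apply: ge_inf; [case: (has_inf_radii x y)|split; [|left]]. Qed.

Let dist_lt x y e : dist x y < e -> e <= 1 -> ball x e y.
Proof.
move=> xye e1; have [r [r0 r1] re] := inf_lt (proj1 (has_inf_radii x y)) xye.
case: r1 => [xy|r1]; first exact: (le_ball (ltW re)).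
by have := lt_le_trans re e1; rewrite ltNge r1.
Qed.

Let dist_ge0 x y : 0 <= dist x y.
Proof.
apply: lb_le_inf; first by case: (has_inf_radii x y).
by move=> e [/ltW].
Qed.

Let distxx x : dist x x = 0.
Proof.
apply/eqP; rewrite eq_le dist_ge0 andbT; apply/ler_addgt0Pr => e e0.
by rewrite add0r; apply: dist_le => //; exact: ballxx.
Qed.

Let dist_positivity x y : dist x y = 0 -> x = y.
Proof.
move=> xy0; apply: hT => A B /nbhs_ballP [e /= e0 eA] By.
exists y; split; last exact: nbhs_singleton.
apply: eA; apply: (@le_ball _ _ _ (Num.min e 1)); first by rewrite ge_min lexx.
by apply: dist_lt; rewrite ?xy0 ?lt_min ?e0 ?ltr01 // ge_min lexx orbT.
Qed.

Let dist_sym x y : dist x y = dist y x.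
Proof.
by congr inf; apply/seteqP; split=> e [e0 [/ball_sym|]]; split => //; [left|right|left|right].
Qed.

Let dist_triangle y x z : dist x z <= dist x y + dist y z.
Proof.
apply/ler_addgt0Pr => e e0.
have e20 : 0 < e / 2 by rewrite divr_gt0.
have [r [r0 xr] rxy] := inf_adherent e20 (has_inf_radii x y).
have [s [s0 ys] syz] := inf_adherent e20 (has_inf_radii y z).
apply: (@le_trans _ _ (r + s)); last first.
  rewrite [e]splitr addrACA; apply: lerD; exact: ltW.
apply: ge_inf; first by case: (has_inf_radii x z).
split; first exact: addr_gt0.
case: xr => [xr|r1]; last by right; rewrite (le_trans r1)// lerDl ltW.
case: ys => [ys|s1]; last by right; rewrite (le_trans s1)// lerDr ltW.
by left; exact: ball_triangle xr ys.
Qed.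

(** A copy of [T] that receives the metric structure without disturbing the
    pseudometric structure of [T]. *)
Definition distance_space : Type := T.

HB.instance Definition _ := Choice.on distance_space.
HB.instance Definition _ := isMetric.Build R distance_space
  distxx dist_positivity dist_sym dist_triangle.

Lemma hausdorff_pseudometric_metrizable : metrizable R T.
Proof.
exists (distance_space : metricType R), (id : T -> distance_space), (id : distance_space -> T).
split => //.
- move=> x U /nbhs_ballP[e /= e0 eU].
  apply/nbhs_ballP; exists (e / 2) => /=; first by rewrite divr_gt0.
  move=> y xy; apply: eU; rewrite ballEmdist /=.
  apply: (@le_lt_trans _ _ (e / 2)); first by apply: dist_le => //; rewrite divr_gt0.
  by rewrite gtr_pMr // invf_lt1 // ltr1n.
- move=> x U /nbhs_ballP[e /= e0 eU].
  apply/nbhs_ballP; exists (Num.min e 1) => /=; first by rewrite lt_min e0 ltr01.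
  move=> y; rewrite ballEmdist /= => xy; apply: eU.
  apply: (@le_ball _ _ _ (Num.min e 1)); first by rewrite ge_min lexx.
  by apply: dist_lt => //; rewrite ge_min lexx orbT.
Qed.

End hausdorff_pseudometric.

(** * Subspaces, products and connected sets *)

Section subtype.
Variables (P : topologicalType) (A : set P).

Lemma set_val_continuous : continuous (val : set_type A -> P).
Proof. exact: initial_continuous. Qed.

Lemma subtype_lift (T : topologicalType) (g : T -> P) :
  continuous g -> (forall s, A (g s)) ->
  exists2 f : T -> set_type A, continuous f & forall s, val (f s) = g s.
Proof.
move=> gc gA; exists (fun s => exist _ (g s) (mem_set (gA s))) => //.
exact: continuous_comp_initial.
Qed.

Lemma subtype_hausdorff : hausdorff_space P -> hausdorff_space (set_type A).
Proof.
move=> hP p q pq; apply: val_inj; apply: hP => U V Up Vq.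
have [r [? ?]] := pq _ _ (set_val_continuous Up) (set_val_continuous Vq).
by exists (val r).
Qed.

Lemma subtype_compact : compact A -> compact [set: set_type A].
Proof.
move=> cA F FF _.
have FA : (val @ F) A.
  by rewrite /= nbhs_simpl /=; apply: filterE => p; exact: set_valP.
have [p [Ap Fp]] := cA (val @ F) _ FA.
exists (exist _ p (mem_set Ap)); split=> // U V FU [_ [[W oW <-] /= Wp WV]].
have FvU : (val @ F) (val @` U).
  rewrite /= nbhs_simpl /=; apply: filterS FU => u Uu; by exists u.
have [_ [[u Uu <-] Wu]] := Fp _ _ FvU (open_nbhs_nbhs (conj oW Wp)).
by exists u; split => //; exact: WV.
Qed.

Lemma subtype_dense (B : set P) :
  (forall p, A p -> closure (A `&` B) p) ->
  dense ((val : set_type A -> P) @^-1` B).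
Proof.
move=> AB O [p Op] [W oW WO]; subst O.
have [q [[Aq Bq] Wq]] := AB _ (set_valP p) _ (open_nbhs_nbhs (conj oW Op)).
by exists (exist _ q (mem_set Aq)).
Qed.
End subtype.

Lemma closure_cvg_seq (T : topologicalType) (A : set T) (q : nat -> T) (p : T) :
  (forall n, A (q n)) -> q @ \oo --> p -> closure A p.
Proof.
move=> qA qp U /qp; rewrite /= nbhs_simpl /= => -[N _ NU].
by exists (q N); split=> //; apply: NU => /=.
Qed.

Section product_cvg.
Variables (I : eqType) (K : topologicalType).
Let P := prod_topology (fun _ : I => K).

Lemma coord_continuous (i : I) : continuous (fun p : P => p i).
Proof. exact: (@proj_continuous I (fun=> K) i). Qed.

Lemma cvg_coord (T : Type) (F : set_system T) (FF : Filter F) (q : T -> P) (p : P) :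
  (forall i, (fun s => q s i) @ F --> p i) -> q @ F --> p.
Proof.
move=> qp; apply/cvg_sup => i U [V] [[W] oW <-] Wp WU.
apply: (filterS WU); apply: (qp i); exact: open_nbhs_nbhs.
Qed.
End product_cvg.

(** The value of [g] at [a] cuts a clopen part out of [C]. *)
Lemma connected_bool_const (T : topologicalType) (g : T -> bool) (C : set T) a b :
  continuous g -> connected C -> C a -> C b -> g a = g b.
Proof.
move=> gc cC Ca Cb.
have := cC (C `&` g @^-1` [set g a]).
move=> /(_ _ _ _)/seteqP[]//.
- by exists a.
- exists (g @^-1` [set g a]) => //.
  by apply: open_comp; [move=> ? _; exact: gc|exact: discrete_open].
- exists (g @^-1` [set g a]) => //.
  by apply: preimage_closed; [move=> ? _; exact: gc|exact: discrete_closed].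
- by move=> _ /(_ _ Cb) [].
Qed.

(** * A sequence returning densely to the unit interval *)

Section clip.
Variable R : realType.

(** Continuous retraction of the line onto the unit interval: arcs can then be
    parametrized by all of [R], without carrying a proof of membership. *)
Definition clip (r : R) : R := Num.max 0 (Num.min r 1).

Lemma clip_itv r : 0 <= clip r <= 1.
Proof. by rewrite /clip le_max lexx /= ge_max ler01 ge_min lexx orbT. Qed.

Lemma clip_id r : 0 <= r <= 1 -> clip r = r.
Proof. by move=> /andP[r0 r1]; rewrite /clip (min_idPl r1) (max_idPr r0). Qed.

Lemma clip_continuous : continuous clip.
Proof.
move=> r; apply: (@continuous_max R R^o (cst 0) (id \min cst 1)); first exact: cvg_cst.
by apply: continuous_min; [exact: cvg_id|exact: cvg_cst].
Qed.

Lemma clip_near (t q e : R) : 0 <= t <= 1 -> t - e < q < t + e -> 0 < e -> `|clip q - t| < e.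
Proof.
move=> /andP[t0 t1] /andP[q1 q2] e0.
have te1 : t - e < 1 by lra.
have te0 : 0 < t + e by lra.
by rewrite /clip ltr_distl lt_max lt_min gt_max gt_min q1 q2 te1 te0 orbT.
Qed.

(** The second component of the decoded pair is ignored, so each rational is
    taken at infinitely many positions. *)
Definition rational_value (m : nat) : R :=
  if (unpickle m : option (rat * nat)) is Some (q, _) then clip (ratr q) else 0.

Lemma rational_value_itv m : 0 <= rational_value m <= 1.
Proof.
rewrite /rational_value; case: unpickle => [[q _]|]; first exact: clip_itv.
by rewrite lexx ler01.
Qed.

Lemma injective_unbounded (f : nat -> nat) (N : nat) : injective f ->
  exists j, (N <= f j)%N.
Proof.
move=> fi; apply: contrapT => nf.
have lt_f j : (f j < N)%N by rewrite ltnNge; apply/negP => Nf; apply: nf; exists j.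
pose g (i : 'I_N.+1) : 'I_N := Ordinal (lt_f i).
have /leq_card : injective g by move=> i j /(congr1 val)/= /fi/ord_inj.
by rewrite !card_ord ltnn.
Qed.

Lemma rational_value_dense (t e : R) (N : nat) : 0 <= t <= 1 -> 0 < e ->
  exists2 m, (N <= m)%N & `|rational_value m - t| < e.
Proof.
move=> t01 e0.
have te : t - e < t + e by lra.
have [q] := rat_in_itvoo te.
rewrite in_itv /= => tq.
have qi : injective (fun j : nat => pickle (q, j)).
  by move=> i j /(pcan_inj pickleK) [].
have [j Nj] := injective_unbounded N qi.
exists (pickle (q, j)) => //.
by rewrite /rational_value pickleK; exact: clip_near.
Qed.
End clip.

(** * Positions of ones in a bit sequence *)

Definition next_one (x : nat -> bool) n m :=
  [/\ (n < m)%N, x n, x m & forall i, (n < i < m)%N -> x i = false].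
Definition last_one (x : nat -> bool) n :=
  x n /\ forall m, (n < m)%N -> x m = false.
Definition inf_ones (x : nat -> bool) := forall n, exists2 m, (n <= m)%N & x m.

Lemma next_or_last (x : nat -> bool) n : x n ->
  last_one x n \/ exists m, next_one x n m.
Proof.
move=> xn; have [ex|nex] := pselect (exists m, (n < m)%N && x m); last first.
  left; split => // m nm; apply/negP => xm; apply: nex; by exists m; rewrite nm.
right; case: (ex_minnP ex) => m /andP[nm xm] mmin; exists m; split => // i /andP[ni im].
by apply/negP => xi; have := mmin i; rewrite ni xi => /(_ isT); rewrite leqNgt im.
Qed.

Lemma inf_or_last (x : nat -> bool) : x 0%N -> ~ inf_ones x -> exists n, last_one x n.
Proof.
move=> x0 /existsNP[N nN].
have bd i : x i -> (i <= N)%N.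
  by move=> xi; rewrite leqNgt; apply/negP => Ni; apply: nN; exists i => //; exact: ltnW.
case: (ex_maxnP (ex_intro _ 0%N x0) bd) => n xn nmax; exists n; split => // m nm.
by apply/negP => /nmax; rewrite leqNgt nm.
Qed.

Lemma last_inf x n : last_one x n -> ~ inf_ones x.
Proof. by move=> [_ xn] /(_ n.+1)[m nm]; rewrite xn. Qed.

Lemma last_uniq x n m : last_one x n -> last_one x m -> n = m.
Proof.
move=> [xn ln] [xm lm]; case: (ltngtP n m) => // [/ln|/lm].
  by rewrite xm.
by rewrite xn.
Qed.

(** * The space and its compactness *)

Section arc_space.
Variable R : realType.

(** The n-th coordinate holds the n-th label, the n-th bit and the n-th height,
    in this order. *)
Definition ambient := prod_topology (fun _ : nat => (bool * bool * R)%type).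
HB.instance Definition _ := Topological.on ambient.
HB.instance Definition _ := PseudoMetric.on ambient.

Definition label (p : ambient) n : bool := (p n).1.1.
Definition bit (p : ambient) n : bool := (p n).1.2.
Definition height (p : ambient) n : R := (p n).2.

(** Stated as a family of closed conditions on finitely many coordinates each;
    in particular heights are constrained separately for every pair of
    consecutive ones. Nothing prescribes the height at the last one, which
    sweeps an arc. The first bit is set so that a point with finitely many ones
    has a last one. *)
Definition carrier (p : ambient) : Prop :=
  [/\ bit p 0, forall n, 0 <= height p n <= 1,
      forall n, bit p n = false -> height p n = 0,
      forall n m, next_one (bit p) n m -> height p n = rational_value R m
    & label p 0 = false -> forall n, label p n = false].

Lemma height_determined p q n : carrier p -> carrier q -> bit p =1 bit q ->
  ~ last_one (bit p) n -> height p n = height q n.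
Proof.
move=> [_ _ p0 pn _] [_ _ q0 qn _] /funext pq nl.
case E : (bit p n); last by rewrite p0 // q0 // -pq.
by have [//|[m nm]] := next_or_last E; rewrite (pn _ _ nm) (qn n m) // -pq.
Qed.

Lemma ambient_eq p q : label p =1 label q -> bit p =1 bit q -> height p =1 height q -> p = q.
Proof.
move=> pqz pqx pqt; apply/funext => n.
by move: (pqz n) (pqx n) (pqt n); rewrite /label /bit /height;
  case: (p n) (q n) => [[? ?] ?] [[? ?] ?] /= -> -> ->.
Qed.

Lemma label_continuous n : continuous (fun p : ambient => label p n).
Proof.
move=> p; apply: (@continuous_comp _ _ _ (fun p : ambient => (p n).1) fst); last exact: cvg_fst.
apply: (@continuous_comp _ _ _ (fun p : ambient => p n) fst); last exact: cvg_fst.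
exact: coord_continuous.
Qed.

Lemma bit_continuous n : continuous (fun p : ambient => bit p n).
Proof.
move=> p; apply: (@continuous_comp _ _ _ (fun p : ambient => (p n).1) snd); last exact: cvg_snd.
apply: (@continuous_comp _ _ _ (fun p : ambient => p n) fst); last exact: cvg_fst.
exact: coord_continuous.
Qed.

Lemma height_continuous n : continuous (fun p : ambient => height p n).
Proof.
move=> p; apply: (@continuous_comp _ _ _ (fun p : ambient => p n) snd); last exact: cvg_snd.
exact: coord_continuous.
Qed.

Lemma cvg_ambient (T : Type) (F : set_system T) (FF : Filter F) (q : T -> ambient) (p : ambient) :
  (forall n, \forall s \near F, label (q s) n = label p n) ->
  (forall n, \forall s \near F, bit (q s) n = bit p n) ->
  (forall n, (fun s => height (q s) n) @ F --> height p n) -> q @ F --> p.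
Proof.
move=> qz qx qt; apply: cvg_coord => n.
have -> : (fun s => q s n) = (fun s => ((label (q s) n, bit (q s) n), height (q s) n)).
  by apply/funext => s; rewrite /label /bit /height; case: (q s n) => [[]].
have -> : p n = ((label p n, bit p n), height p n).
  by rewrite /label /bit /height; case: (p n) => [[]].
apply: (@cvg_pair _ _ _ F (nbhs (label p n, bit p n)) (nbhs (height p n))); last exact: qt.
apply: (@cvg_pair _ _ _ F (nbhs (label p n)) (nbhs (bit p n))).
  by apply: cvg_near_cst; exact: qz.
by apply: cvg_near_cst; exact: qx.
Qed.

Lemma ambient_hausdorff : hausdorff_space ambient.
Proof.
move=> p q pq; apply: ambient_eq => n.
- apply: (@discrete_hausdorff bool) => U V Up Vq.
  have [r [? ?]] := pq _ _ (@label_continuous n _ _ Up) (@label_continuous n _ _ Vq).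
  by exists (label r n).
- apply: (@discrete_hausdorff bool) => U V Up Vq.
  have [r [? ?]] := pq _ _ (@bit_continuous n _ _ Up) (@bit_continuous n _ _ Vq).
  by exists (bit r n).
- apply: (@Rhausdorff R) => U V Up Vq.
  have [r [? ?]] := pq _ _ (@height_continuous n _ _ Up) (@height_continuous n _ _ Vq).
  by exists (height r n).
Qed.

Lemma closed_boolc (g : ambient -> bool) b : continuous g -> closed [set p | g p = b].
Proof.
move=> gc; apply: (@preimage_closed _ _ g [set b]); last exact: discrete_closed.
by move=> ? _; exact: gc.
Qed.

Lemma closed_height n (D : set R) : closed D -> closed [set p | D (height p n)].
Proof.
move=> cD; apply: (@preimage_closed _ _ (height^~ n) D) => // ? _.
exact: height_continuous.
Qed.

Lemma carrier_closed : closed carrier.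
Proof.
have -> : carrier = [set p | bit p 0 = true] `&`
  (\bigcap_n [set p | [set r | 0 <= r <= 1] (height p n)]) `&`
  (\bigcap_n ([set p | bit p n = true] `|` [set p | [set 0] (height p n)])) `&`
  (\bigcap_(nm in [set nm : nat * nat | (nm.1 < nm.2)%N])
    (([set p | bit p nm.1 = false] `|` [set p | bit p nm.2 = false]) `|`
     ((\bigcup_(i in [set i | (nm.1 < i < nm.2)%N]) [set p | bit p i = true]) `|`
      [set p | [set rational_value R nm.2] (height p nm.1)]))) `&`
  (\bigcap_n ([set p | label p 0 = true] `|` [set p | label p n = false])).
  apply/seteqP; split => p.
    move=> [x0 t01 tx tn z0]; do !split => //=.
    - by move=> n _; exact: t01.
    - by move=> n _ /=; case E : (bit p n); [left|right; exact: tx].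
    - move=> [n m] /= nm.
      case xn : (bit p n); last by left; left.
      case xm : (bit p m); last by left; right.
      right; have [ex|nex] := pselect (exists i, (n < i < m)%N /\ bit p i).
        by left; case: ex => i [ni xi]; exists i.
      right; apply: tn; split => // i nim; apply/negP => xi; apply: nex; by exists i.
    - by move=> n _; case E : (label p 0); [left|right; exact: z0].
  move=> [[[[x0 t01] tx] tn] z0]; split => //.
  - by move=> n; exact: t01.
  - by move=> n xn; case: (tx n I) => //=; rewrite xn.
  - move=> n m [nm xn xm nim].
    case: (tn (n, m) nm) => /= [[]|[[i /= ni]|//]]; rewrite ?xn ?xm //.
    by rewrite nim.
  - by move=> z00 n; case: (z0 n I) => //=; rewrite z00.
repeat apply: closedI.
- exact/closed_boolc/bit_continuous.
- apply: closed_bigI => n _; apply: closed_height.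
  have -> : [set r : R | 0 <= r <= 1] = `[0, 1]%classic.
    by apply/seteqP; split => r /=; rewrite in_itv.
  exact: itv_closed.
- apply: closed_bigI => n _; apply: closedU; first exact/closed_boolc/bit_continuous.
  by apply: (@closed_height n [set 0]); exact: closed_eq.
- apply: closed_bigI => -[n m] /= nm; apply: closedU; apply: closedU.
  + exact/closed_boolc/bit_continuous.
  + exact/closed_boolc/bit_continuous.
  + apply: closed_bigcup => [|i _]; last exact/closed_boolc/bit_continuous.
    apply: (@sub_finite_set _ _ `I_m); last exact: finite_II.
    by move=> i /= /andP[].
  + by apply: (@closed_height n [set rational_value R m]); exact: closed_eq.
- by apply: closed_bigI => n _; apply: closedU; exact/closed_boolc/label_continuous.
Qed.

Lemma carrier_compact : compact carrier.
Proof.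
have cfactor : compact ([set: bool * bool] `*` `[(0:R), 1]%classic).
  apply: compact_setX; last exact: segment_compact.
  by rewrite -setXTT; apply: compact_setX; exact: bool_compact.
have := @tychonoff nat (fun=> (bool * bool * R)%type) _ (fun=> cfactor).
move=> /(subclosed_compact carrier_closed); apply => p [_ t01 _ _ _] n /=.
by split => //=; rewrite in_itv; exact: t01.
Qed.

(** * Density and co-density of the points with infinitely many ones *)

(** Only the height [t] at the last one [M] is free. Setting all bits from a far
    position [m] on makes [m] the next one after [M] and forces the height at
    [M] to the value indexed by [m], which can be chosen close to [t]. *)
Lemma carrier_dense_inf (p : ambient) : carrier p ->
  closure (carrier `&` [set q | inf_ones (bit q)]) p.
Proof.
move=> vp; have [x0 t01 tx tn z0] := vp.
have [ip|/(inf_or_last x0)[M lM]] := pselect (inf_ones (bit p)).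
  exact: subset_closure.
have [xM xgt] := lM.
have /choice[m mP] (N : nat) : exists m, [/\ (N <= m)%N, (M < m)%N &
    `|rational_value R m - height p M| < N.+1%:R^-1].
  have [|m] := @rational_value_dense R (height p M) (N.+1%:R^-1) (maxn N M.+1) (t01 M).
    by rewrite invr_gt0.
  by rewrite geq_max => /andP[]; exists m.
pose x' N n := bit p n || (m N <= n)%N.
(* From [m N] on, all bits are ones, so the next one after [n] is [n.+1]. *)
pose t' N n := if (n < M)%N then height p n else if n == M then rational_value R (m N)
  else if (n < m N)%N then 0 else rational_value R n.+1.
pose q N : ambient := fun n => ((label p n, x' N n), t' N n).
have x'le N n : (n <= M)%N -> x' N n = bit p n.
  move=> nM; rewrite /x'; have [_ Mm _] := mP N.
  by rewrite (leqNgt (m N)) (leq_ltn_trans nM Mm) orbF.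
have x'gt N n : (M < n)%N -> x' N n = (m N <= n)%N.
  by move=> Mn; rewrite /x' xgt.
apply: (@closure_cvg_seq _ _ q).
  move=> N; have [Nm Mm _] := mP N; split; last first.
    move=> k; exists (maxn k (m N)); first exact: leq_maxl.
    by rewrite /bit /= /x' leq_maxr orbT.
  split => //.
  - by rewrite /bit /= x'le.
  - move=> n; rewrite /height /= /t'; case: ifP => _; first exact: t01.
    do 2?[case: ifP => _; rewrite ?lexx ?ler01 ?rational_value_itv //].
  - move=> n; rewrite /bit /height /= /t'; case: ltngtP => [nM|nM|->].
    + by rewrite x'le ?(ltnW nM) //; exact: tx.
    + by rewrite x'gt // => /negbT; rewrite -ltnNge => ->.
    + by rewrite x'le // xM.
  - move=> n k [nk]; rewrite /bit /height /= /t' => xn xk xb; case: ltngtP => [nM|nM|nM].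
    + have kM : (k <= M)%N.
        rewrite leqNgt; apply/negP => Mk.
        by have := xb M; rewrite nM Mk x'le // xM => /(_ isT).
      apply: tn; split => //; rewrite -?(x'le N) ?(ltnW nM) // => i /andP[ni ik].
      by rewrite -(x'le N) ?xb ?ni // (leq_trans (ltnW ik)).
    + move: xn; rewrite x'gt // => mn; rewrite ltnNge mn /=; congr rational_value.
      apply/eqP; rewrite eqn_leq nk /= leqNgt; apply/negP => nk'.
      have := xb n.+1; rewrite ltnS leqnn nk' => /(_ isT).
      by rewrite x'gt ?(leq_trans mn) // ltnW.
    + subst n; congr rational_value; move: xk; rewrite x'gt // => mk.
      apply/eqP; rewrite eqn_leq mk /= leqNgt; apply/negP => mk'.
      by have := xb (m N); rewrite Mm mk' x'gt // leqnn => /(_ isT).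
apply: cvg_ambient => n.
- by apply: nearW => N.
- exists n.+1 => // N /= nN; rewrite /bit /= /x' leqNgt; have [Nm _ _] := mP N.
  by rewrite (leq_trans nN) //= orbF.
- rewrite /height /= /t'; case: ltngtP => nM; first exact: cvg_cst.
  + rewrite (_ : (p n).2 = 0); last by apply: tx; exact: xgt.
    apply: cvg_near_cst; exists n.+1 => // N /= nN; have [Nm _ _] := mP N.
    by rewrite (leq_trans nN).
  + subst n; apply/cvgrPdist_lt => e e0.
    near=> N; have [_ _ h] := mP N; rewrite distrC; apply: (lt_trans h).
    by near: N; exact: near_infty_natSinv_lt (PosNum e0).
Unshelve. all: by end_near. Qed.

(** Cutting the ones after a far one [M] alters no height before [M], because
    the next one after any earlier one is at most [M]. *)
Lemma carrier_dense_noninf (p : ambient) : carrier p ->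
  closure (carrier `&` [set q | ~ inf_ones (bit q)]) p.
Proof.
move=> vp; have [x0 t01 tx tn z0] := vp.
have [ip|ip] := pselect (inf_ones (bit p)); last exact: subset_closure.
have /choice[M MP] (N : nat) : exists M, (N <= M)%N /\ bit p M.
  by have [M] := ip N; exists M.
pose x' N n := bit p n && (n <= M N)%N.
pose t' N n := if (n < M N)%N then height p n else 0.
pose q N : ambient := fun n => ((label p n, x' N n), t' N n).
apply: (@closure_cvg_seq _ _ q).
  move=> N; have [NM xM] := MP N; split; last first.
    move=> /(_ (M N).+1)[k Mk]; rewrite /bit /= /x'.
    by rewrite leqNgt Mk andbF.
  split => //.
  - by rewrite /bit /= /x' x0.
  - move=> n; rewrite /height /= /t'; case: ifP => _; first exact: t01.
    by rewrite lexx ler01.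
  - move=> n; rewrite /bit /height /= /t' /x'; case: ltnP => // nM.
    by rewrite (ltnW nM) andbT; exact: tx.
  - move=> n k [nk]; rewrite /bit /height /= /t' /x' => xn /andP[xk kM] xb.
    rewrite (leq_trans nk kM); apply: tn; split => //; first by case/andP: xn.
    move=> i /andP[ni ik]; have := xb i; rewrite ni ik => /(_ isT).
    by rewrite (leq_trans (ltnW ik) kM) andbT.
apply: cvg_ambient => n.
- by apply: nearW => N.
- exists n => // N /= nN; rewrite /bit /= /x'; have [NM _] := MP N.
  by rewrite (leq_trans nN) // andbT.
- apply: cvg_near_cst; exists n.+1 => // N /= nN; rewrite /height /= /t'.
  by have [NM _] := MP N; rewrite (leq_trans nN).
Qed.

(** The point at parameter [r] of the arc through [p], moved to the labels
    [zz]. *)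
Definition arc_point (p : ambient) (zz : nat -> bool) (M : nat) (r : R) : ambient :=
  fun n => ((zz n, bit p n), if n == M then clip r else height p n).

Lemma arc_point_carrier p zz M r : carrier p -> last_one (bit p) M ->
  (zz 0%N = false -> forall n, zz n = false) -> carrier (arc_point p zz M r).
Proof.
move=> [x0 t01 tx tn z0] [xM lM] zz0; split => //.
- by move=> n; rewrite /height /=; case: ifP => _; rewrite ?clip_itv ?t01.
- move=> n xn; rewrite /height /=; case: eqP => [nM|_]; last exact: tx.
  by move: xn; rewrite /bit /= nM xM.
- move=> n m nm; rewrite /height /=; case: eqP => [nM|_]; last exact: tn.
  by case: nm => nm _ + _; rewrite /bit /= lM // -nM.
Qed.

Lemma arc_point_id p M : carrier p -> arc_point p (label p) M (height p M) = p.
Proof.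
move=> [_ t01 _ _ _]; apply: ambient_eq => n //.
by rewrite {1}/height /=; case: eqP => // ->; rewrite clip_id.
Qed.

Lemma arc_point_cvg (T : Type) (F : set_system T) (FF : Filter F) p M
    (zz : T -> nat -> bool) (r : T -> R) zz0 r0 :
  (forall n, \forall s \near F, zz s n = zz0 n) -> r @ F --> r0 ->
  (fun s => arc_point p (zz s) M (r s)) @ F --> arc_point p zz0 M r0.
Proof.
move=> zF rF; apply: cvg_ambient => n.
- exact: zF.
- by apply: nearW.
- rewrite /height /=; case: eqP => _; last exact: cvg_cst.
  by apply: (cvg_comp _ _ rF); exact: clip_continuous.
Qed.

Definition arc_space := set_type carrier.
HB.instance Definition _ := Topological.on arc_space.

Lemma arc_space_label_const (C : set arc_space) a b n : connected C -> C a -> C b ->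
  label (val a) n = label (val b) n.
Proof.
move=> cC Ca Cb; apply: (connected_bool_const _ cC Ca Cb
  (g := fun p : arc_space => label (val p) n)).
move=> p; apply: (@continuous_comp _ _ _ (val : arc_space -> ambient) (fun p => label p n)).
  exact: set_val_continuous.
exact: label_continuous.
Qed.

Lemma arc_space_bit_const (C : set arc_space) a b n : connected C -> C a -> C b ->
  bit (val a) n = bit (val b) n.
Proof.
move=> cC Ca Cb; apply: (connected_bool_const _ cC Ca Cb
  (g := fun p : arc_space => bit (val p) n)).
move=> p; apply: (@continuous_comp _ _ _ (val : arc_space -> ambient) (fun p => bit p n)).
  exact: set_val_continuous.
exact: bit_continuous.
Qed.

Lemma arc_space_arc (p : arc_space) zz M : last_one (bit (val p)) M ->
  (zz 0%N = false -> forall n, zz n = false) ->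
  exists2 f : R -> arc_space, continuous f & forall r, val (f r) = arc_point (val p) zz M r.
Proof.
move=> lM zz0; apply: subtype_lift.
  by move=> r; apply: arc_point_cvg; [by move=> n; exact: nearW|exact: cvg_id].
by move=> r; apply: arc_point_carrier => //; exact: set_valP.
Qed.

(** Labels and bits are constant on a connected set. With infinitely many ones
    they determine the heights, so components there are points; otherwise the
    whole arc of heights at the last one lies in the component. *)
Lemma C1_arc_space : C1 arc_space = [set p | inf_ones (bit (val p))].
Proof.
apply/seteqP; split => p /=.
  move=> Cp; apply: contrapT => nip; have vp := set_valP p.
  have [M lM] : exists M, last_one (bit (val p)) M.
    by apply: inf_or_last => //; case: vp.
  have vz : label (val p) 0 = false -> forall n, label (val p) n = false by case: vp.
  have [f fc fE] := arc_space_arc lM vz.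
  have fp : f (height (val p) M) = p by apply: val_inj; rewrite fE arc_point_id.
  have fC r : f r = p.
    suff : connected_component [set: arc_space] p (f r) by rewrite Cp.
    exists (f @` [set: R]); last by exists r.
    split => //; first by exists (height (val p) M).
    apply: connected_continuous_connected; first exact/connected_intervalP.
    exact: continuous_subspaceT.
  have : height (val (f 0)) M = height (val (f 1)) M by rewrite !fC.
  rewrite !fE /height /= eqxx !clip_id ?lexx ?ler01 // => /esym/eqP.
  by rewrite oner_eq0.
move=> ip; apply/seteqP; split => [q [C [Cp _ cC Cq]]|_ ->]; last exact: connected_component_refl.
have vp := set_valP p; have vq := set_valP q.
have xpq n : bit (val p) n = bit (val q) n by exact: arc_space_bit_const cC Cp Cq.
apply: val_inj; apply: ambient_eq => n //.
- exact: arc_space_label_const cC Cq Cp.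
- by apply/esym; apply: height_determined => // /last_inf.
Qed.

Lemma arc_space_compact : compact [set: arc_space].
Proof. exact: subtype_compact carrier_compact. Qed.

Lemma arc_space_hausdorff : hausdorff_space arc_space.
Proof. exact: subtype_hausdorff ambient_hausdorff. Qed.

Lemma arc_space_metrizable : metrizable R arc_space.
Proof. exact: (hausdorff_pseudometric_metrizable (T := set_type carrier) arc_space_hausdorff). Qed.

Lemma C1_dense : dense (C1 arc_space).
Proof. by rewrite C1_arc_space; apply: subtype_dense carrier_dense_inf. Qed.

Lemma C1_codense : codense (C1 arc_space).
Proof. by rewrite /codense C1_arc_space; apply: subtype_dense carrier_dense_noninf. Qed.

Lemma C1_Gdelta : Gdelta (C1 arc_space).
Proof.
rewrite C1_arc_space.
exists (fun n => \bigcup_(m in [set m | (n <= m)%N]) [set p : arc_space | bit (val p) m = true]).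
  move=> n; apply: bigcup_open => m _.
  apply: (@open_comp _ _ (fun p : arc_space => bit (val p) m) [set true]);
    last exact: discrete_open.
  move=> p _; apply: (@continuous_comp _ _ _ (val : arc_space -> ambient) (fun p => bit p m)).
    exact: set_val_continuous.
  exact: bit_continuous.
apply/seteqP; split => p /=.
  by move=> ip n _; have [m nm xm] := ip n; exists m.
by move=> ip n; have [m nm xm] := ip n I; exists m.
Qed.

(** * The two sides *)

Definition side (b : bool) : set arc_space := [set p | label (val p) 0 = b].

Lemma side_false_eq (a b : arc_space) : side false a -> side false b ->
  bit (val a) =1 bit (val b) ->
  (forall n, last_one (bit (val a)) n -> height (val a) n = height (val b) n) -> a = b.
Proof.
move=> a0 b0 abx abt; have va := set_valP a; have vb := set_valP b.
apply: val_inj; apply: ambient_eq => // n.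
  by case: va vb => [_ _ _ _ ->] // [_ _ _ _ ->].
have [|nl] := pselect (last_one (bit (val a)) n); first exact: abt.
exact: height_determined.
Qed.

(** Two points of [C] share labels and bits, so they differ in the height at the
    last one; these heights fill an interval, which contains a rational. The
    points so found are described by a finite word and a rational, hence form a
    countable set. *)
Lemma connected_rational_last (C : set arc_space) : connected C -> C `<=` side false ->
  (exists a b, [/\ C a, C b & a <> b]) ->
  exists n (q : rat) c, [/\ C c, last_one (bit (val c)) n & height (val c) n = ratr q].
Proof.
move=> cC C0 [a [b [Ca Cb ab]]].
have abx n : bit (val a) n = bit (val b) n by exact: arc_space_bit_const cC Ca Cb.
have [n [lan abt]] : exists n, last_one (bit (val a)) n /\ height (val a) n <> height (val b) n.
  apply: contrapT => nn; apply: ab; apply: side_false_eq => //; [exact: C0|exact: C0|].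
  move=> n lan; apply: contrapT => abt; apply: nn; by exists n.
have /connected_intervalP itvC : connected ((fun p : arc_space => height (val p) n) @` C).
  apply: connected_continuous_connected => //; apply: continuous_subspaceT => p.
  apply: (@continuous_comp _ _ _ (val : arc_space -> ambient) (fun p => height p n)).
    exact: set_val_continuous.
  exact: height_continuous.
have [q [c Cc cq]] : exists q : rat, ((fun p : arc_space => height (val p) n) @` C) (ratr q).
  case: (ltgtP (height (val a) n) (height (val b) n)) => // lt_ab.
  - have [q] := rat_in_itvoo lt_ab; rewrite in_itv /= => /andP[/ltW ? /ltW ?].
    exists q; apply: (itvC (height (val a) n) (height (val b) n)); [by exists a|by exists b|].
    by apply/andP.
  - have [q] := rat_in_itvoo lt_ab; rewrite in_itv /= => /andP[/ltW ? /ltW ?].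
    exists q; apply: (itvC (height (val b) n) (height (val a) n)); [by exists b|by exists a|].
    by apply/andP.
exists n, q, c; split => //.
by have -> : bit (val c) = bit (val a) by apply/funext => i; exact: arc_space_bit_const cC Cc Ca.
Qed.

(** On the side where labels are free, changing labels far away stays in the
    open set [O], so an arc in [O] can be given labels that differ from all
    terms of a prescribed sequence. *)
Lemma open_side_arc (O : set arc_space) (f : nat -> nat -> bool) :
  open O -> O !=set0 -> O `<=` side true ->
  exists C : set arc_space, [/\ connected C, C `<=` O,
    exists a b, [/\ C a, C b & a <> b] &
    forall c, C c -> forall k, label (val c) <> f k].
Proof.
move=> oO O0 Ot.
have [p [Op nip]] := C1_codense O0 oO.
rewrite C1_arc_space /= in nip.
have vp := set_valP p; have zp : label (val p) 0 = true by exact: Ot.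
have [M lM] : exists M, last_one (bit (val p)) M.
  by apply: inf_or_last => //; case: vp.
have [U oU UO] := oO.
have Up : U (val p) by move: Op; rewrite -UO.
(* The labels of [p] up to [N], then a diagonal against [f] shifted by [N]. *)
pose zz N n := if (n < N)%N then label (val p) n else ~~ f (n - N)%N n.
have : (fun s : nat * R => arc_point (val p) (zz s.1) M s.2) @
    filter_prod \oo (nbhs (height (val p) M)) --> val p.
  rewrite -[X in _ --> X](arc_point_id M vp); apply: arc_point_cvg; last exact: cvg_snd.
  move=> n; exists ([set N | (n < N)%N], setT) => /=.
    by split; [exists n.+1|exact: filterT].
  by move=> [N r] [/= nN _]; rewrite /zz nN.
move=> /(_ U (open_nbhs_nbhs (conj oU Up))).
move=> [[A B] [/= [N0 _ AN] /nbhs_ballP[e /= e0 Be]] ABU].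
(* The successor keeps the label at 0 unchanged, so that the labels are free. *)
pose N := N0.+1; pose t := height (val p) M.
have zN0 : zz N 0%N = true by rewrite /zz /= zp.
have zNb : zz N 0%N = false -> forall n, zz N n = false by rewrite zN0.
have [g gc gE] := arc_space_arc lM zNb.
have t01 : 0 <= t <= 1 by case: vp => _ /(_ M).
exists (g @` `]t - e, t + e[%classic); split.
- apply: connected_continuous_connected; last exact: continuous_subspaceT.
  exact/connected_intervalP/interval_is_interval.
- move=> _ [r + <-]; rewrite /= in_itv /= => re; rewrite -UO.
  suff : U (val (g r)) by [].
  rewrite gE.
  apply: (ABU (N, r)); split => /=; first by apply: AN => /=; rewrite /N.
  apply: Be; rewrite /ball /= -/t distrC ltr_distl //.
- have [s [s01 se st]] : exists s, [/\ 0 <= s <= 1, t - e < s < t + e & s <> t].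
    have [t2|t2] := leP t (1 / 2).
      exists (t + Num.min (e / 2) (1 / 2)).
      have m0 : 0 < Num.min (e / 2) (1 / 2) by rewrite lt_min !divr_gt0.
      have me : Num.min (e / 2) (1 / 2) <= e / 2 by rewrite ge_min lexx.
      have m1 : Num.min (e / 2) (1 / 2) <= 1 / 2 by rewrite ge_min lexx orbT.
      by move: m0 me m1; set m := Num.min _ _ => ? ? ?; split; lra.
    exists (t - Num.min (e / 2) (1 / 2)).
    have m0 : 0 < Num.min (e / 2) (1 / 2) by rewrite lt_min !divr_gt0.
    have me : Num.min (e / 2) (1 / 2) <= e / 2 by rewrite ge_min lexx.
    have m1 : Num.min (e / 2) (1 / 2) <= 1 / 2 by rewrite ge_min lexx orbT.
    by move: m0 me m1; set m := Num.min _ _ => ? ? ?; split; lra.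
  exists (g t), (g s); split.
  + by exists t => //=; rewrite in_itv /=; apply/andP; split; lra.
  + by exists s => //=; rewrite in_itv.
  + move=> /(congr1 (fun p : arc_space => height (val p) M)).
    by rewrite !gE /height /= eqxx !clip_id // => /esym.
- move=> _ [r _ <-] k; rewrite gE => /(congr1 (fun u => u (N + k)%N)).
  rewrite /label /= /zz ltnNge leq_addr /= addKn.
  by case: (f k (N + k)%N).
Qed.

(** For each finite word and rational, at most one point of [O] is sent to the
    point of the side without labels that they describe. Take an arc in [O]
    whose labels avoid those of these countably many points: its image is
    connected and has two points, so it contains one of the described
    points. *)
Lemma no_embedding (O : set arc_space) (h : arc_space -> arc_space) :
  open O -> O !=set0 -> O `<=` side true ->
  (forall p, O p -> {for p, continuous h}) ->
  {in O &, injective h} -> ~ (h @` O `<=` side false).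
Proof.
move=> oO O0 Ot hc hi hO.
have [p Op] := O0.
pose code (s : seq bool) (q : rat) : set arc_space :=
  [set o | [/\ O o, bit (val (h o)) =1 nth false s & height (val (h o)) (size s).-1 = ratr q]].
pose f k : nat -> bool :=
  if (unpickle k : option (seq bool * rat)) is Some (s, q) then label (val (xget p (code s q)))
  else xpred0.
have [C [cC CO [a [b [Ca Cb ab]]] Cf]] := open_side_arc f oO O0 Ot.
have OC o : C o -> o \in O by move=> /CO/mem_set.
have chC : connected (h @` C).
  apply: connected_continuous_connected => //; apply: continuous_in_subspaceT => o /set_mem/CO.
  exact: hc.
have hC0 : h @` C `<=` side false.
  by move=> _ [u /CO Ou <-]; apply: hO; exists u.
have h2 : exists a b, [/\ (h @` C) a, (h @` C) b & a <> b].
  exists (h a), (h b); split; [by exists a|by exists b|].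
  by move=> /(hi _ _ (OC _ Ca) (OC _ Cb)).
have [n [q [_ [[c Cc <-] lc tq]]]] := connected_rational_last chC hC0 h2.
(* The default [false] of [nth] accounts for the bits beyond the last one. *)
pose s := mkseq (bit (val (h c))) n.+1.
have xs : bit (val (h c)) =1 nth false s.
  move=> i; have [ni|ni] := ltnP n i; last by rewrite nth_mkseq.
  by rewrite nth_default ?size_mkseq //; case: lc => _ ->.
have sc : code s q c by split => //; [exact: CO|rewrite size_mkseq].
have [Oo ox oq] : code s q (xget p (code s q)) by apply: xgetPex; exists c.
move: Oo ox oq; set o := xget _ _ => Oo ox oq.
have oc : o = c.
  apply: hi; rewrite ?inE //; first exact: CO.
  apply: side_false_eq.
  - by apply: hO; exists o.
  - by apply: hO; exists c => //; exact: CO.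
  - by move=> i; rewrite ox xs.
  - move=> m; rewrite (_ : bit (val (h o)) = bit (val (h c))); last first.
      by apply/funext => i; rewrite ox xs.
    move=> lm; have -> : m = n by exact: last_uniq lm lc.
    by move: oq; rewrite size_mkseq /= tq.
by apply: (Cf c Cc (pickle (s, q))); rewrite /f pickleK -/o oc.
Qed.

Definition base_point (b : bool) (t : R) : ambient :=
  fun n => ((b && (n == 0)%N, (n == 0)%N), if n == 0%N then t else 0).

Lemma base_point_carrier b t : 0 <= t <= 1 -> carrier (base_point b t).
Proof.
move=> t01; split => //.
- by move=> n; rewrite /height /=; case: eqP; rewrite ?lexx ?ler01.
- by move=> n; rewrite /height /bit /= => ->.
- by move=> n m [nm _]; rewrite /bit /=; case: m nm.
- by rewrite /label /= andbT => -> n.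
Qed.

Definition base_arc_space (b : bool) (t : R) (t01 : 0 <= t <= 1) : arc_space :=
  exist (fun p => p \in (carrier : set ambient)) (base_point b t)
    (mem_set (base_point_carrier b t01)).

Lemma arc_space_third_point : third_point arc_space.
Proof.
have t0 : 0 <= (0:R) <= 1 by rewrite lexx ler01.
have t1 : 0 <= (1:R) <= 1 by rewrite lexx ler01.
pose p0 := base_arc_space false t0; pose p1 := base_arc_space false t1.
pose p2 := base_arc_space true t0.
have p01 : p0 <> p1.
  move=> /(congr1 (fun p : arc_space => height (val p) 0)); rewrite /height /= => /esym/eqP.
  by rewrite oner_eq0.
have p02 : p0 <> p2 by move=> /(congr1 (fun p : arc_space => label (val p) 0)).
have p12 : p1 <> p2 by move=> /(congr1 (fun p : arc_space => label (val p) 0)).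
move=> a b; apply: contrapT => n.
have eqab p : p = a \/ p = b.
  by apply: contrapT => /not_orP[pa pb]; apply: n; exists p.
have := eqab p0; have := eqab p1; have := eqab p2.
(* Three distinct points cannot all lie in a pair. *)
by move=> [] e2 [] e1 [] e0;
  first [by apply: p01; rewrite e0 e1|by apply: p02; rewrite e0 e2
        |by apply: p12; rewrite e1 e2].
Qed.

Lemma side_closed b : closed (side b).
Proof.
apply: (@preimage_closed _ _ (fun p : arc_space => label (val p) 0) [set b]);
  last exact: discrete_closed.
move=> p _; apply: (@continuous_comp _ _ _ (val : arc_space -> ambient) (fun p => label p 0)).
  exact: set_val_continuous.
exact: label_continuous.
Qed.

Lemma arc_space_reconstructible : reconstructible arc_space.
Proof.
have t0 : 0 <= (0:R) <= 1 by rewrite lexx ler01.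
apply: (@reconstructible_split _ (side false) (side true)
  (base_arc_space false t0) (base_arc_space true t0)) => //.
- exact: arc_space_compact.
- exact: arc_space_hausdorff.
- exact: arc_space_third_point.
- exact: side_closed.
- exact: side_closed.
- by move=> p; rewrite /side /=; case: (label _ _).
- exact: no_embedding.
Qed.

End arc_space.

Theorem lemma6p6 (R : realType) :
  exists X : topologicalType,
    [/\ [set: X] !=set0, compact [set: X], metrizable R X,
        [/\ dense (C1 X), codense (C1 X) & Gdelta (C1 X)]
      & reconstructible X].
Proof.
exists (arc_space R); split.
- have t0 : 0 <= (0:R) <= 1 by rewrite lexx ler01.
  by exists (base_arc_space false t0).
- exact: arc_space_compact.
- exact: arc_space_metrizable.
- by split; [exact: C1_dense|exact: C1_codense|exact: C1_Gdelta].
- exact: arc_space_reconstructible.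
Qed.
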